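(* Let $k$ be a field, let $G={\rm Spec}\,A$ be a (linearly) semisimple affine $k$-group and let $w_G\in A^*$ be its invariant integral. The morphism $$F\colon A\to A^*,\qquad F(a)=w_G(a^*\cdot -),$$ where $w_G(a^*\cdot -)(a'):=w_G(a^*\cdot a')$, is equal to the inverse morphism of the polarity $\phi\colon\tilde A\to A$ of the trace metric (that is, $F$ takes values in $\tilde A\subseteq A^*$, and $F\colon A\to\tilde A$ and $\phi\colon\tilde A\to A$ are mutually inverse).
   Context: An affine $k$-group $G={\rm Spec}\,A$ is called (linearly) semisimple if it is linearly reductive, i.e. every linear representation of $G$ is completely reducible. $A^*={\rm Hom}_k(A,k)$ is a $k$-algebra with the product dual to the comultiplication of $A$ and unit the identity point $e\in G$. When $G$ is semisimple, $A^*=\prod_i A_i^*$ with $A_i^*$ finite-dimensional simple $k$-algebras, and $A=\bigoplus_i A_i$ where $A_i$ is the dual of $A_i^*$. One puts $\tilde A:=\bigoplus_i A_i^*\subseteq A^*$. The factor of $A^*$ corresponding to the trivial representation $E_0=k$ is $A_0^*=k$, and the invariant integral is $w_G:=1_0\in A^*$, the element with component $1$ in this factor and $0$ in all others; equivalently, $w_G$ is the unique $G$-invariant linear form on $A$ with $w_G(1)=1$. The map $*\colon A\to A$, $a\mapsto a^*$, is the morphism induced by $G\to G$, $g\mapsto g^{-1}$. On $\tilde A$ let $tr(b)=\sum_i tr_{A_i^*}(b_i)$, where $tr_{A_i^*}(b_i)$ is the trace of the endomorphism $b'\mapsto b_ib'$ of $A_i^*$; the trace metric is $T_2(b,b')=tr(bb')$,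 and its polarity is $\phi\colon\tilde A=\bigoplus_i A_i^*\to\bigoplus_i A_i=A$, $\phi(b)(b')=T_2(b,b')$. *)

(* Defs.v *)
From HB Require Import structures.
From mathcomp Require Import all_boot all_order all_algebra.
From mathcomp Require Import boolp classical_sets functions cardinality fsbigop.

Set Implicit Arguments.
Unset Strict Implicit.
Unset Printing Implicit Defensive.

Import GRing.Theory.
Local Open Scope ring_scope.
Local Open Scope classical_set_scope.

Section Tensors.
Variable k : fieldType.

(* A list of pairs s stands for the element \sum_(p <- s) p.1 (x) p.2 of
   V (x) W.  By the universal property, two lists denote the same element iff
   every bilinear map takes the same value on them. *)
Definition tensor_eq (V W : lmodType k) (s t : seq (V * W)) : Prop :=
  forall (U : lmodType k) (B : {bilinear V -> W -> U}),
    \sum_(p <- s) B p.1 p.2 = \sum_(p <- t) B p.1 p.2.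

Definition trilinear (V W X U : lmodType k) (B : V -> W -> X -> U) : Prop :=
  [/\ forall w x, linear (fun v => B v w x),
      forall v x, linear (fun w => B v w x)
    & forall v w, linear (B v w)].

Definition subspace (V : lmodType k) (W : set V) : Prop :=
  W 0 /\ forall (c : k) x y, W x -> W y -> W (c *: x + y).

End Tensors.

(* An affine k-group Spec A, given by its Hopf algebra.  The value of [comul]
   at a is a representative of the comultiplication a |-> (g, h) |-> a (g h);
   all the axioms are equalities in A (x) A or in A (x) A (x) A. *)
Record affine_group (k : fieldType) (A : comAlgType k) := AffineGroup {
  comul : A -> seq (A * A);
  counit : {lrmorphism A -> k^o};
  antipode : {lrmorphism A -> A};
  comul_linear : forall (c : k) (a b : A),
    tensor_eq (comul (c *: a + b))
              ([seq (c *: p.1, p.2) | p <- comul a] ++ comul b);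
  comul1 : tensor_eq (comul 1) [:: (1, 1)];
  comulM : forall a b : A,
    tensor_eq (comul (a * b))
              [seq (p.1 * q.1, p.2 * q.2) | p <- comul a, q <- comul b];
  comulA : forall (U : lmodType k) (B : A -> A -> A -> U), trilinear B ->
    forall a : A,
      \sum_(p <- comul a) \sum_(q <- comul p.1) B q.1 q.2 p.2 =
      \sum_(p <- comul a) \sum_(q <- comul p.2) B p.1 q.1 q.2;
  counitl : forall a : A, \sum_(p <- comul a) counit p.1 *: p.2 = a;
  counitr : forall a : A, \sum_(p <- comul a) counit p.2 *: p.1 = a;
  antipodel : forall a : A,
    \sum_(p <- comul a) antipode p.1 * p.2 = counit a *: 1;
  antipoder : forall a : A,
    \sum_(p <- comul a) p.1 * antipode p.2 = counit a *: 1
}.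

(* A linear representation of Spec A on V, of any dimension, as a right
   comodule V -> V (x) A. *)
Record representation (k : fieldType) (A : comAlgType k) (G : affine_group A)
    (V : lmodType k) := Representation {
  coact : V -> seq (V * A);
  coact_linear : forall (c : k) (v w : V),
    tensor_eq (coact (c *: v + w))
              ([seq (c *: p.1, p.2) | p <- coact v] ++ coact w);
  coactA : forall (U : lmodType k) (B : V -> A -> A -> U), trilinear B ->
    forall v : V,
      \sum_(p <- coact v) \sum_(q <- coact p.1) B q.1 q.2 p.2 =
      \sum_(p <- coact v) \sum_(q <- comul G p.2) B p.1 q.1 q.2;
  coact_counit : forall v : V, \sum_(p <- coact v) counit G p.2 *: p.1 = v
}.

Section Semisimple.
Variables (k : fieldType) (A : comAlgType k) (G : affine_group A).

Definition subrepresentation (V : lmodType k) (M : representation G V)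
    (W : set V) : Prop :=
  subspace W /\
  forall v, W v -> exists s : seq (V * A),
    tensor_eq (coact M v) s /\ forall p, p \in s -> W p.1.

Definition completely_reducible (V : lmodType k) (M : representation G V) :
    Prop :=
  forall W : set V, subrepresentation M W ->
  exists W' : set V, [/\ subrepresentation M W', W `&` W' = [set 0]
    & forall v, exists w w', [/\ W w, W' w' & v = w + w']].

Definition linearly_semisimple : Prop :=
  forall (V : lmodType k) (M : representation G V), completely_reducible M.

End Semisimple.

Section DualAlgebra.
Variables (k : fieldType) (A : comAlgType k) (G : affine_group A).

Local Notation dual := {linear A -> k^o}.

Section Convolution.
Variables b c : dual.

Definition tensor_form (x y : A) : k^o := b x * c y.

Lemma tensor_form_bilinear :
  bilinear_for (GRing.Scale.Law.clone _ _ ( *:%R ) _)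
               (GRing.Scale.Law.clone _ _ ( *:%R ) _) tensor_form.
Proof.
split=> [y | x] a u v; rewrite /tensor_form linearP.
  by rewrite mulrDl -[RHS]/(_ * _ + _) mulrA.
by rewrite mulrDr -[RHS]/(_ * _ + _) mulrCA.
Qed.

HB.instance Definition _ :=
  bilinear_isBilinear.Build k A A k^o *:%R *:%R tensor_form
    tensor_form_bilinear.

Definition conv_fun (a : A) : k^o := \sum_(p <- comul G a) b p.1 * c p.2.

Lemma conv_linear : linear conv_fun.
Proof.
move=> t x y; have /= := comul_linear G t x y tensor_form.
rewrite big_cat big_map /= => E.
rewrite /conv_fun E scaler_sumr; congr (_ + _); apply: eq_bigr => p _.
by rewrite /tensor_form linearZ -[RHS]/(_ * _) -[X in X * _]/(_ * _) mulrA.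
Qed.

HB.instance Definition _ :=
  GRing.isLinear.Build k A k^o *:%R conv_fun conv_linear.

End Convolution.

(* The product of A^*, dual to the comultiplication. *)
Definition conv (b c : dual) : dual := conv_fun b c.

(* For a subspace C of A, linear forms on A extend those on C, so the dual C^*
   is A^* modulo [annihilator C], as an algebra if C is a subcoalgebra. *)
Definition annihilator (C : set A) : set dual :=
  [set b | forall x, C x -> b x = 0].

Definition subcoalgebra (C : set A) : Prop :=
  subspace C /\
  forall x, C x -> exists s : seq (A * A),
    tensor_eq (comul G x) s /\ forall p, p \in s -> C p.1 /\ C p.2.

Definition finite_dim (C : set A) : Prop :=
  exists (n : nat) (e : 'I_n -> A), forall x, C x ->
    exists c : 'I_n -> k, x = \sum_(i < n) c i *: e i.

Definition two_sided_ideal (J : set dual) : Prop :=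
  [/\ J (\0 : dual),
      forall (t : k) (b c d : dual),
        J b -> J c -> (forall x, d x = t *: b x + c x) -> J d
    & forall b c, J b -> J (conv b c) /\ J (conv c b)].

(* C^* is a simple algebra: it is nonzero, and its two-sided ideals, which are
   those of A^* containing the kernel of A^* -> C^*, are 0 and C^*. *)
Definition simple_dual (C : set A) : Prop :=
  (exists x, C x /\ x <> 0) /\
  forall J : set dual, two_sided_ideal J -> annihilator C `<=` J ->
    J = annihilator C \/ J = setT.

(* The summands A_i: as C is finite-dimensional, the restriction A^* -> C^* is
   the projection of A^* = \prod_i A_i^* onto a simple factor. *)
Definition blocks : set (set A) :=
  [set C | [/\ subcoalgebra C, finite_dim C & simple_dual C]].

(* The direct sum of the A_i^*, inside A^* = \prod_i A_i^*. *)
Definition Atilde : set dual :=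
  [set b | finite_set [set C | blocks C /\ ~ annihilator C b]].

(* e is a basis of C and f restricts to the dual basis of C^*. *)
Definition dual_bases (C : set A) (n : nat) (e : 'I_n -> A)
    (f : 'I_n -> dual) : Prop :=
  [/\ forall i, C (e i), forall i j, f i (e j) = (i == j)%:R
    & forall x, C x -> x = \sum_(i < n) f i x *: e i].

(* The trace of the endomorphism b' |-> b b' of C^*; it does not depend on the
   basis in which the matrix is written. *)
Definition tr_dual (C : set A) (b : dual) : k :=
  xget 0 [set t | exists n (e : 'I_n -> A) (f : 'I_n -> dual),
    dual_bases C e f /\ t = \tr (\matrix_(i, j) (conv b (f j) (e i) : k))].

Definition tr (b : dual) : k := \sum_(C \in blocks) tr_dual C b.

Definition trace_metric (b b' : dual) : k := tr (conv b b').

(* An element a of A = \bigoplus_i A_i, A_i the dual of A_i^*, is the linear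
   form b' |-> b' a on Atilde. *)
Definition is_polarity (phi : Atilde -> A) : Prop :=
  forall b b' : Atilde, \val b' (phi b) = trace_metric (\val b) (\val b').

(* The matrix coefficients of the trivial representation. *)
Definition trivial_block : set A := range (fun c : k => c *: (1 : A)).

(* w = 1_0: the unit, namely the counit, in the factor of the trivial
   representation and 0 in all the others. *)
Definition invariant_integral (w : dual) : Prop :=
  (forall x, trivial_block x -> w x = counit G x) /\
  forall C, blocks C -> C <> trivial_block -> annihilator C w.

Section IntegralMap.
Variables (w : dual) (a : A).

Definition integral_form_fun (x : A) : k^o := w (antipode G a * x).

Lemma integral_form_linear : linear integral_form_fun.
Proof.
by move=> t x y; rewrite /integral_form_fun mulrDr -scalerAr linearP.
Qed.

HB.instance Definition _ :=
  GRing.isLinear.Build k A k^o *:%R integral_form_fun integral_form_linear.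

End IntegralMap.

(* F a = w (a^* . -) *)
Definition integral_form (w : dual) (a : A) : dual := integral_form_fun w a.

End DualAlgebra.

(* Main.v *)
Require Import Defs.
From HB Require Import structures.
From mathcomp Require Import all_boot all_order all_algebra.
From mathcomp Require Import boolp classical_sets functions cardinality fsbigop.

Set Implicit Arguments.
Unset Strict Implicit.
Unset Printing Implicit Defensive.

Import GRing.Theory.
Local Open Scope ring_scope.
Local Open Scope classical_set_scope.

(** The dual algebra acts on A on both sides: a form b sends x to
    b(x_1) x_2 (here [hitl]) or to b(x_2) x_1 (here [hitr]).  The subspaces
    stable under both actions are the subcoalgebras, and those stable under
    [hitr] are the subrepresentations of the regular representation.

    Semisimplicity is used to decompose A.  A subcoalgebra D has a complement
    D' which is stable under [hitr]; the projection onto D is then the action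
    of one form e, and D' is itself a subcoalgebra as soon as i e = 0 for every
    form i that vanishes on D.  These products form a left ideal of square
    zero, which acts as zero on the semisimple regular representation, so they
    do vanish ([bistable_complement]).  As every element lies in a
    finite-dimensional subcoalgebra, induction on the dimension shows that A is
    spanned by its minimal subcoalgebras, which are the blocks
    ([blocks_span]); distinct blocks intersect in 0 ([blocks_disjoint]).

    Write S for the antipode.  Since w vanishes on the nontrivial blocks, it is
    invariant: w(x_1) x_2 = w(x) 1.  It follows that w S = w, so that the
    pairing F(a)(x) = w(S(a) x) is symmetric, and that
    F(a)(x_1) x_2 = a_1 w(S(a_2) x) = F(x)(a_2) a_1
    ([hitl_integral_form]).  By this last identity, for a in a block C the form
    F(a) vanishes on the other blocks, so it lies in [Atilde].

    For such an a, and any form b, the trace of F(a) b is that of the operator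
    x |-> y_1 F(x)(y_2) of C, where y = b(a_1) a_2.  This operator has finite
    rank, with trace F(y_1)(y_2) = w(S(y_1) y_2) = counit(y) w(1) = b(a).  Hence
    tr(F(a) b) = b(a) for all a and b ([integral_form_metric]).

    This gives the theorem: if phi is a polarity and b is in [Atilde], then
    F(phi(b))(x) = F(x)(phi(b)) = tr(b F(x)) = tr(F(x) b) = b(x), and F is
    injective because b(a) = tr(F(a) b). *)

(** * Linear maps and subspaces *)

Section LinearMaps.
Variable k : fieldType.

Lemma dualZ (V : lmodType k) (b : {linear V -> k^o}) c x :
  b (c *: x) = c * b x.
Proof. exact: linearZ. Qed.

(** Many linear maps below exist only inside a proof, obtained by choice or as
    nested sums over comultiplications; this bundles them there. *)
Lemma mk_linear (V U : lmodType k) (f : V -> U) :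
  linear f -> {g : {linear V -> U} | g =1 f}.
Proof.
move=> fL; pose m := GRing.isLinear.Build k V U *:%R f fL.
by exists (HB.pack f m : {linear V -> U}).
Qed.

Lemma linear_eq (V U : lmodType k) (f g : {linear V -> U}) : f =1 g -> f = g.
Proof.
case: f g => f Hf [g Hg] /= /funext fg.
move: fg Hf Hg => /= -> [[a] [b]] [[c] [d]].
by rewrite (Prop_irrelevance a c) (Prop_irrelevance b d).
Qed.

Definition bilinear_map (V W U : lmodType k) (B : V -> W -> U) : Prop :=
  (forall w, linear (B^~ w)) /\ forall v, linear (B v).

(** Equality of tensors quantifies over bundled bilinear maps; this form
    accepts any function with a proof of bilinearity. *)
Lemma tensor_eq_map (V W U : lmodType k) (B : V -> W -> U) s t :
  bilinear_map B -> tensor_eq s t ->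
  \sum_(p <- s) B p.1 p.2 = \sum_(p <- t) B p.1 p.2.
Proof.
move=> [Bl Br] st.
have H : bilinear_for (GRing.Scale.Law.clone _ _ ( *:%R ) _)
               (GRing.Scale.Law.clone _ _ ( *:%R ) _) B.
  by split=> [w|v] c x y /=; [exact: Bl|exact: Br].
pose m := bilinear_isBilinear.Build k V W U *:%R *:%R B H.
exact: (st U (HB.pack B m : {bilinear V -> W -> U})).
Qed.

Lemma dualP (V : lmodType k) (b : {linear V -> k^o}) c x y :
  b (c *: x + y) = c * b x + b y.
Proof. by rewrite linearD dualZ. Qed.

Lemma bilinear_mapP (V W U : lmodType k) (B : {bilinear V -> W -> U}) :
  bilinear_map B.
Proof.
split=> [w|v] c x y; last by rewrite linearPr.
by rewrite (linearDl B) (linearZl_LR B).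
Qed.

Lemma linear_sum_of (V U : lmodType k) (f : V -> U) (I : Type) (r : seq I) g :
  linear f -> f (\sum_(i <- r) g i) = \sum_(i <- r) f (g i).
Proof.
by move=> /mk_linear[h hE]; rewrite -hE linear_sum; under eq_bigr do rewrite hE.
Qed.

Lemma linearZ_of (V U : lmodType k) (f : V -> U) c x :
  linear f -> f (c *: x) = c *: f x.
Proof. by move=> /mk_linear[h hE]; rewrite -!hE linearZ. Qed.

Lemma sum_linear (V U : lmodType k) (I : Type) (r : seq I) (f : I -> V -> U) :
  (forall i, linear (f i)) -> linear (fun x => \sum_(i <- r) f i x).
Proof.
move=> fL c x y; rewrite scaler_sumr -big_split.
by apply: eq_bigr => i _; rewrite fL.
Qed.

Section Subspace.
Variables (V : lmodType k) (W : set V).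
Hypothesis WS : subspace W.

Lemma subspaceZ c x : W x -> W (c *: x).
Proof. by case: WS => W0 WL Wx; rewrite -[_ *: _]addr0; apply: WL. Qed.

Lemma subspaceD x y : W x -> W y -> W (x + y).
Proof. by case: WS => _ WL Wx; rewrite -[x]scale1r; apply: WL. Qed.

Lemma subspaceB x y : W x -> W y -> W (x - y).
Proof. by move=> Wx Wy; rewrite -scaleN1r; apply/subspaceD/subspaceZ. Qed.

Lemma subspace_sum (I : eqType) (r : seq I) (g : I -> V) :
  (forall i, i \in r -> W (g i)) -> W (\sum_(i <- r) g i).
Proof.
elim: r => [|i r IH] Wg; first by rewrite big_nil; case: WS.
rewrite big_cons; apply: subspaceD; first by apply: Wg; rewrite mem_head.
by apply: IH => j jr; apply: Wg; rewrite inE jr orbT.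
Qed.

End Subspace.

End LinearMaps.

(** * Complements, linear forms and tensors *)

Section Complements.
Variables (k : fieldType) (A : comAlgType k) (G : affine_group A).
Hypothesis ssG : linearly_semisimple G.

Definition complement (V : lmodType k) (W W' : set V) : Prop :=
  W `&` W' = [set 0] /\ forall v, exists w w', [/\ W w, W' w' & v = w + w'].

(** The trivial representation v |-> v (x) 1 on V has all subspaces of V as
    subrepresentations, so semisimplicity splits them. *)
Lemma subspace_complement (V : lmodType k) (W : set V) :
  subspace W -> exists W', subspace W' /\ complement W W'.
Proof.
move=> WS.
have L c (v w : V) :
  tensor_eq [:: (c *: v + w, 1 : A)]
    ([seq (c *: p.1, p.2) | p <- [:: (v, 1 : A)]] ++ [:: (w, 1)]).
  move=> U B; rewrite !big_cons !big_nil /= !addr0.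
  by rewrite (linearDl B) (linearZl_LR B).
have CA (U : lmodType k) (B : V -> A -> A -> U) : trilinear B -> forall v : V,
    \sum_(p <- [:: (v, 1 : A)]) \sum_(q <- [:: (p.1, 1 : A)]) B q.1 q.2 p.2 =
    \sum_(p <- [:: (v, 1 : A)]) \sum_(q <- comul G p.2) B p.1 q.1 q.2.
  move=> [_ B2 B3] v; rewrite !big_cons !big_nil /= !addr0.
  have Bv : bilinear_map (B v) by split=> x; [exact: B2|exact: B3].
  by rewrite (tensor_eq_map Bv (comul1 G)) big_cons big_nil addr0.
have Ce (v : V) : \sum_(p <- [:: (v, 1 : A)]) counit G p.2 *: p.1 = v.
  by rewrite big_cons big_nil /= addr0 rmorph1 scale1r.
pose M := Representation L CA Ce.
case: (@ssG V M W).
  split=> // v Wv; exists [:: (v, 1)]; split=> // p.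
  by rewrite inE => /eqP ->.
by move=> W' [[W'S _] WW' WD]; exists W'.
Qed.

Lemma complement_projection (V : lmodType k) (W W' : set V) :
  subspace W -> subspace W' -> complement W W' ->
  exists P : {linear V -> V}, [/\ forall v, W (P v), forall v, W' (v - P v)
    & forall v w, W w -> W' (v - w) -> P v = w].
Proof.
move=> WS W'S [WW' WD].
have uniq v w w' : W w -> W' (v - w) -> W w' -> W' (v - w') -> w = w'.
  move=> Ww W'w Ww' W'w'; apply/eqP; rewrite -subr_eq0; apply/eqP.
  suff : (W `&` W') (w - w') by rewrite WW'.
  split; first exact: subspaceB.
  have -> : w - w' = (v - w') - (v - w).
    by rewrite opprB [RHS]addrC addrA addrNK.
  exact: subspaceB.
have ex v : exists w, W w /\ W' (v - w).
  by have [w [w' [? ? ->]]] := WD v; exists w; rewrite addrAC subrr add0r.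
pose f v := projT1 (cid (ex v)).
have fP v : W (f v) /\ W' (v - f v) by rewrite /f; case: cid.
have fL : linear f.
  move=> c x y; apply: (uniq (c *: x + y)).
  - exact: (fP _).1.
  - exact: (fP _).2.
  - by apply: WS.2; exact: (fP _).1.
  have -> : c *: x + y - (c *: f x + f y) = c *: (x - f x) + (y - f y).
    by rewrite scalerBr opprD addrACA.
  by apply: W'S.2; exact: (fP _).2.
have [P PE] := mk_linear fL; exists P; split=> [v|v|v w Ww W'w].
- by rewrite PE; exact: (fP _).1.
- by rewrite PE; exact: (fP _).2.
- by rewrite PE; apply: uniq W'w; [exact: (fP _).1|exact: (fP _).2|].
Qed.

Lemma subspace_projection (V : lmodType k) (W : set V) : subspace W ->
  exists P : {linear V -> V}, (forall v, W (P v)) /\ forall v, W v -> P v = v.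
Proof.
move=> WS; have [W' [W'S /(complement_projection WS W'S)[P [P1 P2 P3]]]] :=
  subspace_complement WS.
exists P; split=> // v Wv; apply: P3 => //; rewrite subrr; exact: W'S.1.
Qed.

(** Compose the projection away from W with the coordinate along the image of
    x. *)
Lemma form_separates_subspace (V : lmodType k) (W : set V) x :
  subspace W -> ~ W x ->
  exists b : {linear V -> k^o}, (forall y, W y -> b y = 0) /\ b x = 1.
Proof.
move=> WS Wx; have [P [PW PE]] := subspace_projection WS.
pose z := x - P x.
have z0 : z != 0.
  by apply/eqP => /subr0_eq xE; apply: Wx; rewrite xE.
pose L := range (fun c : k => c *: z).
have LS : subspace L.
  split=> [|c _ _ [a _ <-] [b _ <-]]; first by exists 0; rewrite ?scale0r.
  by exists (c * a + b); rewrite // scalerDl scalerA.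
have [Q [QL QE]] := subspace_projection LS.
pose h v : k^o := projT1 (cid2 (QL (v - P v))).
have hE v : h v *: z = Q (v - P v) by rewrite /h; case: cid2.
have hu c v : Q (v - P v) = c *: z -> h v = c.
  rewrite -hE => /eqP; rewrite -subr_eq0 -scalerBl scaler_eq0 (negPf z0) orbF.
  by rewrite subr_eq0 => /eqP.
have hL : linear h.
  move=> c u v; apply: hu; rewrite scalerDl -scalerA !hE -linearP linearP.
  by rewrite scalerBr opprD addrACA.
have [b bE] := mk_linear hL; exists b; split=> [y Wy|]; rewrite bE; apply: hu.
  by rewrite PE // subrr linear0 scale0r.
by rewrite scale1r QE //; exists 1; rewrite ?scale1r.
Qed.

Lemma forms_separate_points (V : lmodType k) (x y : V) :
  (forall b : {linear V -> k^o}, b x = b y) -> x = y.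
Proof.
move=> bxy; apply: contrapT => xy.
have [||b [_]] := @form_separates_subspace V [set 0] (x - y).
- by split=> // c _ _ -> ->; rewrite /= scaler0 addr0.
- by move=> /= /subr0_eq.
- by rewrite linearB bxy subrr => /esym/eqP; rewrite oner_eq0.
Qed.

(** The alternative on which the reduction of a tensor to linearly independent
    factors rests. *)
Lemma in_span_or_separated (V W : lmodType k) (w : W) (s : seq (V * W)) :
  (exists c : nat -> k, w = \sum_(i < size s) c i *: (nth (0, 0) s i).2) \/
  exists b : {linear W -> k^o}, (forall p, p \in s -> b p.2 = 0) /\ b w = 1.
Proof.
pose L : set W :=
  [set w | exists c : nat -> k,
     w = \sum_(i < size s) c i *: (nth (0, 0) s i).2].
have LS : subspace L.
  split; first by exists (fun=> 0); rewrite big1 // => i _; rewrite scale0r.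
  move=> c _ _ [a ->] [b ->]; exists (fun i => c * a i + b i).
  rewrite scaler_sumr -big_split; apply: eq_bigr => i _.
  by rewrite scalerDl scalerA.
case: (pselect (L w)) => [Lw|/(form_separates_subspace LS)[b [bL bw]]].
  by left.
right; exists b; split=> // p ps; apply: bL.
have ip : (index p s < size s)%N by rewrite index_mem.
exists (fun i => (i == index p s)%:R); rewrite (bigD1 (Ordinal ip)) //=.
rewrite eqxx scale1r nth_index // big1 ?addr0 // => i.
by rewrite -val_eqE /= => /negPf ->; rewrite scale0r.
Qed.

(** Injectivity of the map from V (x) W to Hom(W^*, V).  If the factor w of
    the first pair (v, w) depends on the others, the pair can be absorbed in
    them; otherwise a form isolates v and shows that it is 0.  Either way the
    tensor becomes shorter. *)
Lemma tensor_eq0_forms (V W : lmodType k) (s : seq (V * W)) :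
  (forall b : {linear W -> k^o}, \sum_(p <- s) b p.2 *: p.1 = 0) ->
  tensor_eq s [::].
Proof.
elim: {s}(size s) {-2}s (erefl (size s)) => [|n IH] s.
  by move=> /size0nil ->.
case: s => [//|[v w] s] [sn] s0.
case: (in_span_or_separated w s) => [[c wE]|[b [bs bw]]]; last first.
  have v0 : v = 0.
    have := s0 b; rewrite big_cons /= bw scale1r big_seq big1 ?addr0 //.
    by move=> p /bs ->; rewrite scale0r.
  subst v; have {}s0 (b' : {linear W -> k^o}) :
      \sum_(p <- s) b' p.2 *: p.1 = 0.
    by have := s0 b'; rewrite big_cons /= scaler0 add0r.
  move=> U B; rewrite big_cons /= (linear0l B) add0r; exact: IH.
(* As w is the combination of the other factors with coefficients c, v (x) w
   is distributed over the pairs of s. *)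
pose s' := [seq ((nth (0, 0) s i).1 + c i *: v, (nth (0, 0) s i).2)
  | i <- iota 0 (size s)].
have sE (U : lmodType k) (B : V -> W -> U) : bilinear_map B ->
    \sum_(p <- (v, w) :: s) B p.1 p.2 = \sum_(p <- s') B p.1 p.2.
  move=> [Bl Br]; rewrite big_cons /s' big_map /=.
  have -> : iota 0 (size s) = index_iota 0 (size s).
    by rewrite /index_iota subn0.
  rewrite big_mkord (big_nth (0, 0)) big_mkord.
  rewrite {1}wE (linear_sum_of _ _ (Br v)) -big_split; apply: eq_bigr => i _ /=.
  rewrite (linearZ_of _ _ (Br v)) [_ + c i *: v]addrC (Bl _ (c i) v).
  by [].
have {}IH : tensor_eq s' [::].
  apply: IH => [|b]; first by rewrite size_map size_iota.
  rewrite -(sE _ (fun x y => b y *: x)) ?s0 //.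
  split=> [y|x] a u u'; first by rewrite scalerDr !scalerA mulrC.
  by rewrite linearP scalerDl scalerA.
move=> U B; rewrite -IH; apply: sE.
exact: bilinear_mapP.
Qed.

Lemma tensor_eq_forms (V W : lmodType k) (s t : seq (V * W)) :
  (forall (b : {linear V -> k^o}) (c : {linear W -> k^o}),
    \sum_(p <- s) b p.1 * c p.2 = \sum_(p <- t) b p.1 * c p.2) ->
  tensor_eq s t.
Proof.
move=> st U B; apply/eqP; rewrite -subr_eq0; apply/eqP.
pose u := s ++ [seq (- p.1, p.2) | p <- t].
have uE (f : V -> W -> U) : (forall y, linear (f ^~ y)) ->
    \sum_(p <- u) f p.1 p.2 = \sum_(p <- s) f p.1 p.2 - \sum_(p <- t) f p.1 p.2.
  move=> fL; rewrite big_cat big_map -sumrN; congr (_ + _).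
  apply: eq_bigr => p _ /=; rewrite -scaleN1r.
  by rewrite (linearZ_of (f := f ^~ p.2)) ?scaleN1r //; exact: fL.
rewrite -uE; last by move=> y; exact: (bilinear_mapP B).1.
rewrite (tensor_eq0_forms _) ?big_nil // => c.
apply: forms_separate_points => b; rewrite linear0 big_cat big_map.
rewrite linearD !linear_sum; apply/eqP; rewrite addr_eq0 -sumrN; apply/eqP.
under eq_bigr => p _ do rewrite dualZ mulrC.
rewrite st; apply: eq_bigr => p _ /=.
by rewrite dualZ linearN mulrN opprK mulrC.
Qed.

End Complements.

(** * Finite-dimensional subspaces *)

Section Span.
Variables (k : fieldType) (V : lmodType k).
Implicit Types (s : seq V) (x y : V).

(** The recursion follows the inductions in which spanning vectors are removed
    one at a time. *)
Fixpoint seq_span s : set V :=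
  if s is e :: s' then [set x | exists c : k, seq_span s' (x - c *: e)]
  else [set 0].

Lemma span_subspace s : subspace (seq_span s).
Proof.
elim: s => [|e s [s0 sL]] /=.
  by split=> // c _ _ -> ->; rewrite /= scaler0 addr0.
split=> [|c x y [a ax] [b bx]]; first by exists 0; rewrite scale0r subr0.
exists (c * a + b); have := sL c _ _ ax bx; congr (seq_span s _).
by rewrite scalerBr scalerDl scalerA opprD addrACA.
Qed.

Lemma mem_span s x : x \in s -> seq_span s x.
Proof.
elim: s => //= e s IH; rewrite inE => /orP[/eqP ->|/IH sx].
  by exists 1; rewrite scale1r subrr; exact: (span_subspace s).1.
by exists 0; rewrite scale0r subr0.
Qed.

Lemma span_map (T : {linear V -> V}) s x :
  seq_span s x -> seq_span [seq T e | e <- s] (T x).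
Proof.
elim: s x => [x -> |e s IH x [c /IH]] /=; first by rewrite linear0.
by rewrite linearB linearZ; exists c.
Qed.

Lemma span_coord s x :
  seq_span s x -> exists c : nat -> k, x = \sum_(i < size s) c i *: s`_i.
Proof.
elim: s x => [x -> |e s IH x [c /IH[d dE]]].
  by exists (fun=> 0); rewrite big_ord0.
exists (fun i => if i is j.+1 then d j else c).
rewrite big_ord_recl /= -[LHS](addrNK (c *: e)) dE addrC; congr (_ + _).
Qed.

(** A form that is nonzero on a span cuts its dimension: if b e is nonzero,
    the remaining vectors, projected to the kernel of b along e, span that
    kernel. *)
Lemma span_kernel s (b : {linear V -> k^o}) x : seq_span s x -> b x != 0 ->
  exists s', (size s' < size s)%N /\
    forall y, seq_span s y -> b y = 0 -> seq_span s' y.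
Proof.
elim: s x => [x -> |e s IH x /= [c cx] bx]; first by rewrite linear0 eqxx.
have [be|be] := eqVneq (b e) 0.
  have [|s' [ss' sP]] := IH _ cx; first by rewrite linearB dualZ be mulr0 subr0.
  exists (e :: s'); split=> // y [d dy] y0 /=; exists d; apply: sP => //.
  by rewrite linearB dualZ be mulr0 subr0.
(* The projection onto the kernel of b along e. *)
have TL : linear (fun z => z - (b z / b e) *: e).
  move=> t u v; rewrite dualP mulrDl scalerDl opprD addrACA -mulrA -scalerA.
  by rewrite scalerBr.
have [T TE] := mk_linear TL.
exists [seq T z | z <- s]; rewrite size_map; split=> // y [d dy] y0.
have -> : y = T (y - d *: e).
  rewrite TE linearB dualZ y0 add0r mulNr mulfK // scaleNr opprK.
  by rewrite subrK.
exact: span_map.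
Qed.

End Span.

Section DualBases.
Variables (k : fieldType) (A : comAlgType k).
Local Notation dual := {linear A -> k^o}.

Lemma dual_comb (t : k) (i j : dual) :
  {h : dual | forall x, h x = t * i x + j x}.
Proof.
have L : linear (fun x => t * i x + j x : k^o).
  move=> c x y; rewrite (dualP i) (dualP j) -[RHS]/(c * _ + _) !mulrDr.
  by rewrite addrACA mulrCA.
by have [h hE] := mk_linear L; exists h.
Qed.

Lemma finite_dim_span (C : set A) :
  finite_dim C <-> exists s, forall x, C x -> seq_span s x.
Proof.
split=> [[n [e eE]]|[s sE]].
  exists [seq e i | i <- enum 'I_n] => x /eE[c ->].
  apply: (subspace_sum (span_subspace _)) => i _.
  apply: (subspaceZ (span_subspace _)); apply: mem_span; apply: map_f.
  by rewrite mem_enum.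
exists (size s), (fun i => s`_i) => x /sE/span_coord[c ->].
by exists (fun i => c i).
Qed.

(** A space J of forms that separates the points of a finite-dimensional C
    contains forms dual to some basis of C.  Take x in C and f in J with f x =
    1, and recurse on the kernel of f in C with the forms of J that kill x. *)
Lemma dual_bases_exist (C : set A) (J : set dual) (s : seq A) :
  subspace C -> (forall x, C x -> seq_span s x) ->
  (forall (t : k) (b c d : dual),
     J b -> J c -> (forall x, d x = t * b x + c x) -> J d) ->
  (forall x, C x -> x <> 0 -> exists2 j, J j & j x <> 0) ->
  exists n (e : 'I_n -> A) (f : 'I_n -> dual),
    dual_bases C e f /\ forall i, J (f i).
Proof.
have [m sm] : {m | (size s < m)%N} by exists (size s).+1.
elim: m s sm C J => [//|m IH] s sm C J CS Cs JL Jsep.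
have [[x [Cx x0]]|C0] := pselect (exists x, C x /\ x <> 0); last first.
  exists 0%N, (fun=> 0), (fun=> \0); split; last by case.
  split=> [[]|[]|x Cx] //; rewrite big_ord0.
  by apply: contrapT => x0; apply: C0; exists x.
have [j Jj jx] := Jsep _ Cx x0; have {}jx : j x != 0 by apply/eqP.
(* This is j / j x, written as a combination of two elements of J. *)
have [f0 f0E] := dual_comb ((j x)^-1 - 1) j j.
have Jf0 : J f0 by exact: JL f0E.
have f0x : f0 x = 1 by rewrite f0E mulrBl mul1r subrK mulVf.
have [|s' [ss' s'P]] := span_kernel (b := f0) (Cs _ Cx).
  by rewrite f0x oner_neq0.
pose C1 := [set y | C y /\ f0 y = 0]; pose J1 := [set g | J g /\ g x = 0].
have [|||||n [e [f [[eC ef Ce] fJ]]]] := IH s' _ C1 J1.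
- exact: leq_trans ss' _.
- split; first by split; [exact: CS.1|rewrite linear0].
  move=> c u v [Cu u0] [Cv v0]; split; first exact: CS.2.
  by rewrite dualP u0 v0 mulr0 addr0.
- by move=> y [Cy y0]; apply: s'P => //; exact: Cs.
- move=> t b c d [Jb b0] [Jc c0] dE; split; first exact: JL dE.
  by rewrite dE b0 c0 mulr0 addr0.
- move=> y [Cy y0] yn0; have [g Jg gy] := Jsep _ Cy yn0.
  (* Subtracting g x times f0 makes the form vanish at x without changing it
     on the kernel of f0. *)
  have [h hE] := dual_comb (- g x) f0 g.
  exists h; last by rewrite hE y0 mulr0 add0r.
  by split; [exact: JL hE|rewrite hE f0x mulr1 addNr].
exists n.+1, (fun i => if unlift ord0 i is Some j then e j else x).
exists (fun i => if unlift ord0 i is Some j then f j else f0).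
split; last by move=> i; case: unliftP => [i' _|_] //; exact: (fJ _).1.
split=> [i|i i'|y Cy].
- by case: unliftP => [i' _|_] //; exact: (eC _).1.
- case: unliftP => [a -> |->]; case: unliftP => [b -> |->].
  + by rewrite ef (inj_eq lift_inj).
  + by rewrite (fJ _).2.
  + by rewrite (eC _).2.
  + by rewrite f0x.
rewrite big_ord_recl unlift_none; under eq_bigr do rewrite liftK.
have : C1 (y - f0 y *: x).
  split; last by rewrite linearB dualZ f0x mulr1 subrr.
  by apply: subspaceB => //; exact: subspaceZ.
move/Ce => yE; rewrite -[LHS](subrK (f0 y *: x)) addrC {1}yE; congr (_ + _).
by apply: eq_bigr => i _; rewrite linearB dualZ (fJ i).2 mulr0 subr0.
Qed.

End DualBases.

(** * The actions of the dual algebra on the coordinate ring *)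

Section Sweedler.
Variables (k : fieldType) (A : comAlgType k) (G : affine_group A).
Local Notation dual := {linear A -> k^o}.

Lemma comul_sum_linear (U : lmodType k) (B : A -> A -> U) :
  bilinear_map B -> linear (fun a => \sum_(p <- comul G a) B p.1 p.2).
Proof.
move=> BB c x y; rewrite (tensor_eq_map BB (comul_linear G c x y)).
rewrite big_cat big_map scaler_sumr; congr (_ + _).
apply: eq_bigr => p _ /=.
by rewrite (linearZ_of (f := B ^~ p.2)) //; exact: BB.1.
Qed.

(** The transpose of the left multiplication by b in A^*. *)
Definition hitl (b : dual) (a : A) : A := \sum_(p <- comul G a) b p.1 *: p.2.

(** The transpose of the right multiplication by b in A^*; A becomes a left
    module over A^* in this way. *)
Definition hitr (b : dual) (a : A) : A := \sum_(p <- comul G a) b p.2 *: p.1.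

Lemma scale_left_bilinear (b : dual) :
  bilinear_map (fun x y : A => b x *: y).
Proof.
split=> [y|x] c u v; first by rewrite linearP scalerDl scalerA.
by rewrite scalerDr !scalerA mulrC.
Qed.

Lemma scale_right_bilinear (b : dual) :
  bilinear_map (fun x y : A => b y *: x).
Proof. by have [? ?] := scale_left_bilinear b; split. Qed.

Lemma hitl_linear b : linear (hitl b).
Proof. exact: comul_sum_linear (scale_left_bilinear b). Qed.

Lemma hitr_linear b : linear (hitr b).
Proof. exact: comul_sum_linear (scale_right_bilinear b). Qed.

HB.instance Definition _ b :=
  GRing.isLinear.Build k A A *:%R (hitl b) (hitl_linear b).
HB.instance Definition _ b :=
  GRing.isLinear.Build k A A *:%R (hitr b) (hitr_linear b).

Lemma convE (b c : dual) x :
  conv G b c x = \sum_(p <- comul G x) b p.1 * c p.2.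
Proof. by []. Qed.

Lemma form_hitl (b c : dual) x : c (hitl b x) = conv G b c x.
Proof. by rewrite linear_sum; apply: eq_bigr => p _; rewrite dualZ. Qed.

Lemma form_hitr (b c : dual) x : c (hitr b x) = conv G c b x.
Proof. by rewrite linear_sum; apply: eq_bigr => p _; rewrite dualZ mulrC. Qed.

Lemma convA (b c d : dual) x :
  conv G (conv G b c) d x = conv G b (conv G c d) x.
Proof.
pose B u v w : k^o := b u * c v * d w.
have BT : trilinear B.
  split=> [v w|u w|u v] t z z'; rewrite /B dualP -[RHS]/(t * _ + _).
  - by rewrite !mulrDl -!mulrA.
  - by rewrite mulrDr mulrDl -!mulrA mulrCA.
  - by rewrite mulrDr mulrCA.
have := comulA G BT x; rewrite /B => E.
transitivity (\sum_(p <- comul G x) \sum_(q <- comul G p.1)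
  b q.1 * c q.2 * d p.2).
  by apply: eq_bigr => p _; rewrite convE mulr_suml.
rewrite E; apply: eq_bigr => p _.
by rewrite convE mulr_sumr; apply: eq_bigr => q _; rewrite mulrA.
Qed.

Lemma hitl_counit x : hitl (counit G) x = x.
Proof. exact: counitl. Qed.

Lemma hitr_counit x : hitr (counit G) x = x.
Proof. exact: counitr. Qed.

Lemma counit_hitl b x : counit G (hitl b x) = b x.
Proof. by rewrite form_hitl -form_hitr hitr_counit. Qed.

Lemma counit_hitr b x : counit G (hitr b x) = b x.
Proof. by rewrite form_hitr -form_hitl hitl_counit. Qed.

Hypothesis ssG : linearly_semisimple G.

Lemma hitl_hitl b c x : hitl b (hitl c x) = hitl (conv G c b) x.
Proof.
by apply: (forms_separate_points ssG) => d; rewrite !form_hitl convA.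
Qed.

Lemma hitr_hitr b c x : hitr b (hitr c x) = hitr (conv G b c) x.
Proof.
by apply: (forms_separate_points ssG) => d; rewrite !form_hitr convA.
Qed.

Lemma hitl_hitr b c x : hitl b (hitr c x) = hitr c (hitl b x).
Proof.
apply: (forms_separate_points ssG) => d.
by rewrite form_hitl !form_hitr form_hitl convA.
Qed.

(** Stability under all forms replaces the choice of a tensor with components
    in C: the two notions agree by [subcoalgebraP]. *)
Definition bistable (C : set A) : Prop :=
  subspace C /\ forall b x, C x -> C (hitl b x) /\ C (hitr b x).

(** If C is stable under both actions, applying a projection onto C to both
    components of the comultiplication of an element of C does not change its
    pairing with any two forms. *)
Lemma subcoalgebraP (C : set A) : subcoalgebra G C <-> bistable C.
Proof.
split=> [[CS CD]|[CS CD]]; split=> //.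
  move=> b x Cx; have [s [xs sC]] := CD _ Cx; split.
    rewrite /hitl (tensor_eq_map (scale_left_bilinear b) xs).
    by apply: subspace_sum => // p /sC[_ ?]; exact: subspaceZ.
  rewrite /hitr (tensor_eq_map (scale_right_bilinear b) xs).
  by apply: subspace_sum => // p /sC[? _]; exact: subspaceZ.
move=> x Cx; have [P [PC PE]] := subspace_projection ssG CS.
exists [seq (P p.1, P p.2) | p <- comul G x]; split; last first.
  by move=> _ /mapP[p _ ->]; split; exact: PC.
apply: (tensor_eq_forms ssG) => b c; rewrite big_map.
(* The projection is inserted in one component at a time: each partial
   evaluation of the comultiplication of x already lies in C. *)
pose cP : dual := (c \o P); pose bP : dual := (b \o P).
have /= <- : conv G bP cP x = \sum_(p <- comul G x) b (P p.1) * c (P p.2) by [].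
rewrite -[LHS]/(conv G b c x) -form_hitl -[hitl b x]PE;
  last exact: (CD _ _ Cx).1.
rewrite -[LHS]/(cP (hitl b x)) form_hitl -form_hitr -[hitr _ x]PE.
  by rewrite -[LHS]/(bP (hitr cP x)) form_hitr.
exact: (CD _ _ Cx).2.
Qed.

Definition regular_representation : representation G A :=
  Representation (comul_linear G) (@comulA _ _ G) (@counitr _ _ G).

Lemma right_complement (C : set A) : subspace C ->
  (forall b x, C x -> C (hitr b x)) ->
  exists C', [/\ subspace C', forall b x, C' x -> C' (hitr b x)
    & complement C C'].
Proof.
move=> CS CD; have [] := ssG (M := regular_representation) (W := C).
  split=> // x Cx; have [P [PC PE]] := subspace_projection ssG CS.
  exists [seq (P p.1, p.2) | p <- comul G x]; split; last first.
    by move=> _ /mapP[p _ ->]; exact: PC.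
  apply: (tensor_eq_forms ssG) => b c; rewrite big_map.
  pose bP : dual := (b \o P).
  rewrite -[RHS]/(conv G bP c x) -[LHS]/(conv G b c x) -!form_hitr.
  by rewrite -[RHS]/(b (P (hitr c x))) PE //; exact: CD.
move=> C' [[C'S C'D] CC' CE]; exists C'; split=> // b x C'x.
have [s [xs sC]] := C'D _ C'x.
rewrite /hitr (tensor_eq_map (scale_right_bilinear b) xs).
by apply: subspace_sum => // p /sC ?; exact: subspaceZ.
Qed.

End Sweedler.

(** * Complements of subcoalgebras *)

Section BistableComplement.
Variables (k : fieldType) (A : comAlgType k) (G : affine_group A).
Local Notation dual := {linear A -> k^o}.
Hypothesis ssG : linearly_semisimple G.

(** By duality this says that the annihilator of C is a right ideal; here hitr
    c x stays in C for every form c. *)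
Lemma annihilator_hitl (C : set A) (i : dual) x :
  bistable G C -> annihilator C i -> C x -> hitl G i x = 0.
Proof.
move=> [_ CD] Ci Cx; apply: (forms_separate_points ssG) => c.
by rewrite form_hitl -form_hitr linear0 Ci //; exact: (CD _ _ Cx).2.
Qed.

Lemma annihilator_hitr (C : set A) (i : dual) x :
  bistable G C -> annihilator C i -> C x -> hitr G i x = 0.
Proof.
move=> [_ CD] Ci Cx; apply: (forms_separate_points ssG) => c.
by rewrite form_hitr -form_hitl linear0 Ci //; exact: (CD _ _ Cx).1.
Qed.

Lemma annihilator_ideal (C : set A) :
  bistable G C -> two_sided_ideal G (annihilator C).
Proof.
move=> CB; split=> [x //|t b c d Cb Cc dE x Cx|b c Cb].
  by rewrite dE Cb // Cc // scaler0 addr0.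
split=> x Cx.
  by rewrite -form_hitl (annihilator_hitl CB Cb Cx) linear0.
by rewrite -form_hitr (annihilator_hitr CB Cb Cx) linear0.
Qed.

(** Let e be the counit composed with the projection P onto S along a right
    complement S', so that P is the action of e.  If i vanishes on S, then e i
    = 0; therefore the products i e multiply to zero among themselves, and
    semisimplicity makes them act as zero.  Given v in S' and a form b, the
    vector hitl b v is also hitl i v, where i is b corrected to vanish on S,
    and its projection to S is the action of i e. *)
Lemma bistable_complement (S : set A) : bistable G S ->
  exists S', bistable G S' /\ complement S S'.
Proof.
move=> SB; have [SS SD] := SB.
have [|S' [S'S S'D SS']] := right_complement ssG SS.
  by move=> b x Sx; exact: (SD _ _ Sx).2.
exists S'; split=> //; split=> // b v S'v; split; last exact: S'D.
have [P [P1 P2 P3]] := complement_projection SS S'S SS'.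
have PS x : S x -> P x = x.
  by move=> Sx; apply: P3 => //; rewrite subrr; exact: S'S.1.
have PS' x : S' x -> P x = 0.
  by move=> S'x; apply: P3; rewrite ?subr0 //; exact: SS.1.
have Phitr c x : P (hitr G c x) = hitr G c (P x).
  apply: P3; first exact: (SD _ _ (P1 x)).2.
  by rewrite -linearB; exact: S'D.
pose e : dual := counit G \o P.
have PE x : P x = hitl G e x.
  apply: (forms_separate_points ssG) => c.
  by rewrite form_hitl -form_hitr /e /= Phitr counit_hitr.
have e_i (i : dual) x : annihilator S i -> conv G e i x = 0.
  by move=> Si; rewrite -form_hitl -PE Si.
have i_e (i : dual) x : annihilator S i -> hitr G i (hitr G e x) = 0.
  move=> Si; set y := hitr G e x.
  (* The submodule generated by x under the left ideal of the products i e. *)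
  pose L := [set z | exists2 j, annihilator S j & z = hitr G j y].
  have LS : subspace L.
    split.
      exists (\0 : dual); first by [].
      by rewrite /hitr big1 // => p _; rewrite scale0r.
    move=> c _ _ [j Sj ->] [j' Sj' ->]; have [h hE] := dual_comb c j j'.
    exists h; first by move=> z Sz; rewrite hE Sj // Sj' // mulr0 addr0.
    rewrite /hitr scaler_sumr -big_split; apply: eq_bigr => p _.
    by rewrite hE scalerDl scalerA.
  have [|Z [ZS ZD [LZ LZE]]] := right_complement ssG LS.
    move=> c _ [j Sj ->]; exists (conv G c j); last by rewrite hitr_hitr.
    by have [_ _ /(_ j c Sj)[]] := annihilator_ideal SB.
  have [z [u [[j Sj zE] Zu xE]]] := LZE x.
  suff : (L `&` Z) (hitr G i y) by rewrite LZ.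
  split; first by exists i.
  (* On the component z in L the action vanishes because e j = 0; on the
     component u it stays in Z, hence is 0 as it also lies in L. *)
  rewrite /y xE !linearD /=; suff -> : hitr G e z = 0.
    by rewrite linear0 add0r; exact: (ZD _ _ (ZD _ _ Zu)).
  rewrite zE hitr_hitr // /hitr big1 // => p _.
  by rewrite e_i // scale0r.
pose i : dual := b \o (idfun \- P).
have Si : annihilator S i by move=> x Sx; rewrite /i /= PS // subrr linear0.
have -> : hitl G b v = hitl G i v.
  apply: (forms_separate_points ssG) => c.
  by rewrite !form_hitl -!form_hitr /i /= PS' ?subr0 //; exact: S'D.
rewrite -[hitl _ _ _]subr0; suff <- : P (hitl G i v) = 0 by exact: P2.
rewrite PE hitl_hitl // /hitl big1 // => p _.
by rewrite -(counit_hitr G) -hitr_hitr // i_e // linear0 scale0r.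
Qed.

End BistableComplement.

(** * Decomposition into blocks *)

Section Blocks.
Variables (k : fieldType) (A : comAlgType k) (G : affine_group A).
Local Notation dual := {linear A -> k^o}.
Hypothesis ssG : linearly_semisimple G.

Lemma bistableI (C D : set A) :
  bistable G C -> bistable G D -> bistable G (C `&` D).
Proof.
move=> [[C0 CL] CD] [[D0 DL] DD]; split; first split=> //.
  by move=> c x y [Cx Dx] [Cy Dy]; split; [exact: CL|exact: DL].
by move=> b x [/(CD b)[? ?] /(DD b)[? ?]]; do !split.
Qed.

Lemma block_bistable C : blocks G C -> bistable G C.
Proof. by case=> /(subcoalgebraP ssG). Qed.

Lemma block_dual_bases C : blocks G C ->
  exists n (e : 'I_n -> A) (f : 'I_n -> dual), dual_bases C e f.
Proof.
move=> CB; have [CS _] := block_bistable CB.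
case: CB => _ /finite_dim_span[s Cs] _.
have [//||n [e [f [ef _]]]] := @dual_bases_exist _ _ C setT s CS Cs.
- move=> x _ x0; apply: contrapT => nex; apply: x0.
  apply: (forms_separate_points ssG) => b; rewrite linear0.
  by apply: contrapT => bx; apply: nex; exists b.
by exists n, e, f.
Qed.

(** The annihilator of a subcoalgebra D of C is an ideal, which by simplicity
    is either the annihilator of C or everything. *)
Lemma block_minimal C D : blocks G C -> bistable G D -> D `<=` C ->
  (exists x, D x /\ x <> 0) -> D = C.
Proof.
move=> CB DB DC [x [Dx x0]]; apply/seteqP; split=> // y Cy.
have [_ _ [_ /(_ (annihilator D) (annihilator_ideal ssG DB))]] := CB.
case.
- by move=> b Cb z Dz; apply: Cb; exact: DC.
- move=> DE; apply: contrapT => Dy.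
  have [b [bD by1]] := form_separates_subspace ssG DB.1 Dy.
  have : annihilator D b by [].
  by rewrite DE => /(_ _ Cy); rewrite by1 => /eqP; rewrite oner_eq0.
- move=> DE; case: x0; apply: (forms_separate_points ssG) => b.
  by rewrite linear0; have : annihilator D b by [rewrite DE]; apply.
Qed.

(** The elements of C killed by an ideal J form a subcoalgebra, hence 0 or C.
    If it is C, then J is the annihilator of C.  If it is 0, then J separates
    the points of C, so it contains a basis of the dual of C, and with the
    annihilator of C all forms. *)
Lemma minimal_block C s : bistable G C -> (forall x, C x -> seq_span s x) ->
  (exists x, C x /\ x <> 0) ->
  (forall D, bistable G D -> D `<=` C -> (exists x, D x /\ x <> 0) ->
     C `<=` D) ->
  blocks G C.
Proof.
move=> CB Cs C0 Cmin; split.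
- exact/(subcoalgebraP ssG).
- by apply/finite_dim_span; exists s.
split=> // J [J0 JL JM] CJ.
pose D := [set x | C x /\ forall b, J b -> b x = 0].
have DB : bistable G D.
  split=> [|b x [Cx Jx]].
    split; first by split=> [|b _]; [exact: CB.1.1|exact: linear0].
    move=> c x y [Cx xJ] [Cy yJ]; split=> [|b Jb]; first exact: CB.1.2.
    by rewrite dualP xJ // yJ // mulr0 addr0.
  have [? ?] := CB.2 b x Cx; split; split=> // c Jc.
    by rewrite form_hitl Jx //; exact: (JM c b Jc).2.
  by rewrite form_hitr Jx //; exact: (JM c b Jc).1.
have [Dn0|D0] := pselect (exists x, D x /\ x <> 0).
  left; apply/seteqP; split=> // b Jb x Cx.
  by have [|_] := Cmin D DB _ Dn0 x Cx; [move=> y []|exact].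
right; apply/seteqP; split=> // b _.
have [|n [e [f [[eC ef Ce] fJ]]]] := @dual_bases_exist _ _ C J s CB.1 Cs JL.
  move=> x Cx x0; apply: contrapT => nex; apply: D0; exists x; split=> //.
  split=> // j Jj; apply: contrapT => jx; apply: nex; by exists j.
have sumJ (r : seq 'I_n) : exists2 h, J h &
    forall x, h x = \sum_(i <- r) b (e i) * f i x.
  elim: r => [|i r [h Jh hE]]; first by exists \0 => // x; rewrite big_nil.
  have [h' h'E] := dual_comb (b (e i)) (f i) h.
  exists h'; first exact: JL h'E.
  by move=> x; rewrite big_cons h'E hE.
(* h agrees with b on C, and b - h is in J because it vanishes on C. *)
have [h Jh hE] := sumJ (enum 'I_n).
have [g gE] := dual_comb (-1) h b.
apply: (JL 1 h g) => // [|x].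
  apply: CJ => x Cx; rewrite gE hE big_enum {2}[x]Ce // linear_sum.
  rewrite mulN1r addrC; apply/eqP; rewrite subr_eq0; apply/eqP.
  by apply: eq_bigr => i _; rewrite dualZ mulrC.
by rewrite gE mulN1r scale1r addNKr.
Qed.

Lemma blocks_disjoint C D : blocks G C -> blocks G D -> C <> D ->
  C `&` D = [set 0].
Proof.
move=> CB DB CD; have CDB := bistableI (block_bistable CB) (block_bistable DB).
apply/seteqP; split=> [x CDx|_ ->]; last exact: CDB.1.1.
apply: contrapT => x0; apply: CD.
have ex : exists x, (C `&` D) x /\ x <> 0 by exists x.
rewrite -(block_minimal CB CDB (@subIsetl _ _ _) ex).
exact: (block_minimal DB CDB (@subIsetr _ _ _) ex).
Qed.

(** The elements whose images under all hitl b o hitr c lie in the span of the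
    middle factors of the double comultiplication of x.  Taking the largest
    stable subspace of that span avoids any sum over pairs of forms. *)
Lemma bistable_hull x :
  exists D s, [/\ bistable G D, D x & forall y, D y -> seq_span s y].
Proof.
pose s := flatten [seq [seq q.2 | q <- comul G p.1] | p <- comul G x].
pose D := [set y | forall b c, seq_span s (hitl G b (hitr G c y))].
exists D, s; split.
- split; first split=> [b c|t y z Dy Dz b c].
  + by rewrite !linear0; exact: (span_subspace s).1.
  + rewrite (linearP (hitr G c)) (linearP (hitl G b)).
    by apply: (span_subspace s).2; [exact: Dy|exact: Dz].
  + move=> b y Dy; split=> c d; first by rewrite -hitl_hitr // hitl_hitl.
    by rewrite hitr_hitr.
- move=> b c; rewrite /hitr linear_sum; apply: (subspace_sum (span_subspace _)).
  move=> p px; rewrite linearZ; apply: (subspaceZ (span_subspace _)).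
  apply: (subspace_sum (span_subspace _)) => q qp.
  apply: (subspaceZ (span_subspace _)); apply: mem_span.
  by apply/flatten_mapP; exists p => //; exact: map_f.
by move=> y /(_ (counit G) (counit G)); rewrite hitr_counit hitl_counit.
Qed.

(** A nonzero finite-dimensional subcoalgebra D is a block, or the sum of a
    proper nonzero subcoalgebra C and of the intersection of D with a
    complement of C.  Both lie in spans of fewer vectors: a form that vanishes
    on the part but not on D cuts the dimension. *)
Lemma blocks_span (P : set A) : subspace P ->
  (forall C, blocks G C -> C `<=` P) -> forall x, P x.
Proof.
move=> PS PB x; have [D [s [DB Dx Ds]]] := bistable_hull x.
have [n sn] : {n | (size s < n)%N} by exists (size s).+1.
elim: n s sn D DB Ds x Dx => [//|n IH] s sn D DB Ds x Dx.
have [->|/eqP x0] := eqVneq x 0; first exact: PS.1.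
have [DC|nDC] := pselect (blocks G D); first exact: PB Dx.
have [C [CB CD [c [Cc c0]] [d [Dd Cd]]]] : exists C, [/\ bistable G C, C `<=` D,
    exists c, C c /\ c <> 0 & exists d, D d /\ ~ C d].
  apply: contrapT => nex; apply: nDC; apply: minimal_block Ds _ _ => //.
    by exists x.
  move=> C CB CD Cn0 y Dy; apply: contrapT => Cy; apply: nex.
  by exists C; split=> //; exists y.
have [E [EB [CE0 CE]]] := bistable_complement ssG CB.
have IHsub (F : set A) y : bistable G F -> F `<=` D -> D y -> ~ F y ->
    forall z, F z -> P z.
  move=> FB FD Dy Fy; have [b [bF by1]] := form_separates_subspace ssG FB.1 Fy.
  have [|s' [ss' s'P]] := span_kernel (b := b) (Ds _ Dy).
    by rewrite by1 oner_neq0.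
  apply: IH (leq_trans ss' sn) _ FB _ => z Fz.
  by apply: s'P; [exact/Ds/FD|exact: bF].
have [y [z [Cy Ez xE]]] := CE x; rewrite xE; apply: subspaceD => //.
  exact: IHsub Cd _ Cy.
apply: (IHsub (D `&` E) c) => //; first exact: bistableI.
- exact: CD _ Cc.
- by move=> [_ Ec]; apply: c0; have : (C `&` E) c by []; rewrite CE0.
split=> //; have -> : z = x - y by rewrite xE addrAC subrr add0r.
by apply: subspaceB => //; [exact: DB.1|exact: CD].
Qed.

End Blocks.

(** * The antipode *)

Section Antipode.
Variables (k : fieldType) (A : comAlgType k) (G : affine_group A).
Local Notation dual := {linear A -> k^o}.
Local Notation S := (antipode G).
Local Notation eps := (counit G).

(** Both S o S and the identity are convolution inverses of S: compute
    S(S(x_1)) S(x_2) x_3 in two ways. *)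
Lemma antipodeK : involutive S.
Proof.
move=> x; pose B (u v t : A) := S (S u) * S v * t.
have BT : trilinear B.
  split=> [v t|u t|u v] c y z; rewrite /B.
  - by rewrite !linearP !mulrDl -!scalerAl.
  - by rewrite linearP mulrDr mulrDl -scalerAr -scalerAl.
  - by rewrite mulrDr -scalerAr.
have := comulA G BT x; rewrite /B.
have -> : \sum_(p <- comul G x) \sum_(q <- comul G p.1)
    S (S q.1) * S q.2 * p.2 = x.
  rewrite -[RHS](counitl G); apply: eq_bigr => p _; rewrite -mulr_suml.
  under eq_bigr do rewrite -rmorphM.
  by rewrite -linear_sum antipodel linearZ rmorph1 -scalerAl mul1r.
move=> E; rewrite [RHS]E -[in LHS](counitr G x) !linear_sum.
apply: eq_bigr => p _.
under eq_bigr do rewrite -mulrA.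
by rewrite -mulr_sumr antipodel !linearZ -scalerAr mulr1.
Qed.

Definition mul_form (b : dual) (u x : A) : k^o := b (u * x).

Lemma mul_form_linear b u : linear (mul_form b u).
Proof. by move=> t x y; rewrite /mul_form mulrDr -scalerAr linearP. Qed.

HB.instance Definition _ b u :=
  GRing.isLinear.Build k A k^o *:%R (mul_form b u) (mul_form_linear b u).

Lemma form_mul_bilinear (b c : dual) (u v : A) :
  bilinear_map (fun x y : A => b (x * u) * c (y * v) : k^o).
Proof.
split=> [y|x] t z z'; rewrite mulrDl -scalerAl dualP -[RHS]/(t * _ + _).
  by rewrite mulrDl mulrA.
by rewrite mulrDr mulrCA.
Qed.

Lemma comul_mul_forms (b c : dual) x y :
  conv G b c (x * y) = \sum_(p <- comul G x) \sum_(q <- comul G y)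
    b (p.1 * q.1) * c (p.2 * q.2).
Proof.
rewrite convE.
have := tensor_eq_map (form_mul_bilinear b c 1 1) (comulM G x y).
under eq_bigr do rewrite !mulr1.
move=> ->; rewrite big_allpairs_dep.
by apply: eq_bigr => p _; apply: eq_bigr => q _; rewrite /= !mulr1.
Qed.

(** The form version of (z_1 (x) z_2) (S(z_4) (x) S(z_3)) = counit(z) 1 (x) 1:
    the two inner factors cancel, then the two outer ones. *)
Lemma comul_antipode_cancel (b c : dual) z :
  \sum_(p <- comul G z) \sum_(q <- comul G p.1) \sum_(r <- comul G p.2)
    b (q.1 * S r.2) * c (q.2 * S r.1) = eps z * (b 1 * c 1).
Proof.
pose T (u v t : A) : k^o :=
  \sum_(r <- comul G t) b (u * S r.2) * c (v * S r.1).
have TT : trilinear T.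
  split=> [v t|u t|u v].
  - apply: sum_linear => r d x y.
    by rewrite mulrDl -scalerAl dualP mulrDl -mulrA.
  - apply: sum_linear => r d x y.
    by rewrite mulrDl -scalerAl dualP mulrDr mulrCA.
  - apply: (@comul_sum_linear _ _ G _
      (fun x y : A => b (u * S y) * c (v * S x) : k^o)).
    split=> [y|x] d m n; rewrite linearP mulrDr -scalerAr dualP.
      by rewrite mulrDr mulrCA.
    by rewrite mulrDl -mulrA.
rewrite (comulA G TT z) /T.
have E (p : A * A) : \sum_(q <- comul G p.2) \sum_(r <- comul G q.2)
    b (p.1 * S r.2) * c (q.1 * S r.1) = b (p.1 * S p.2) * c 1.
  pose T' (u v t : A) : k^o := b (p.1 * S t) * c (u * S v).
  have TT' : trilinear T'.
    split=> [v t|u t|u v] d m n; rewrite /T'.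
    - by rewrite mulrDl -scalerAl dualP mulrDr mulrCA.
    - by rewrite linearP mulrDr -scalerAr dualP mulrDr mulrCA.
    - by rewrite linearP mulrDr -scalerAr dualP mulrDl -mulrA.
  rewrite -(comulA G TT' p.2) /T'.
  rewrite -[in RHS](counitl G p.2) linear_sum mulr_sumr linear_sum mulr_suml.
  apply: eq_bigr => q _; rewrite -mulr_sumr -linear_sum antipoder (dualZ c).
  rewrite linearZ.
  by rewrite -[X in _ = b X * _]scalerAr (dualZ b) mulrCA mulrA.
under eq_bigr do rewrite E.
by rewrite -mulr_suml -linear_sum antipoder dualZ mulrA.
Qed.

(** The antipode reverses the comultiplication, because a |-> comul (S a) and
    a |-> S(a_2) (x) S(a_1) are convolution inverses of comul, on the left and
    on the right.  The proof evaluates comul (S(a_1) a_2) (S(a_4) (x) S(a_3))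
    in two ways, after pairing with b (x) c. *)
Lemma comul_antipode (b c : dual) a :
  conv G b c (S a) = conv G (c \o S : dual) (b \o S : dual) a.
Proof.
pose K (y z : A) : k^o := \sum_(q <- comul G z) \sum_(p <- comul G y)
  b (p.1 * S q.2) * c (p.2 * S q.1).
have Kl z : linear (K^~ z).
  apply: sum_linear => q.
  exact: comul_sum_linear (form_mul_bilinear _ _ _ _).
have Kr y : linear (K y).
  apply: (@comul_sum_linear _ _ G _ (fun u v : A => \sum_(p <- comul G y)
     b (p.1 * S v) * c (p.2 * S u) : k^o)).
  split=> [v|u]; apply: sum_linear => p d m n;
    rewrite linearP mulrDr -scalerAr dualP.
    by rewrite mulrDr mulrCA.
  by rewrite mulrDl -mulrA.
have K1 z : K 1 z = conv G (c \o S : dual) (b \o S : dual) z.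
  apply: eq_bigr => q _.
  rewrite (tensor_eq_map (form_mul_bilinear b c (S q.2) (S q.1)) (comul1 G)).
  by rewrite big_cons big_nil addr0 !mul1r mulrC.
have KM y z : \sum_(q <- comul G z) K (y * q.1) q.2 = eps z * conv G b c y.
  transitivity (\sum_(p <- comul G y) eps z * (b p.1 * c p.2)); last first.
    by rewrite -mulr_sumr.
  transitivity (\sum_(q <- comul G z) \sum_(r <- comul G q.2)
      \sum_(p <- comul G y) \sum_(m <- comul G q.1)
      b (p.1 * (m.1 * S r.2)) * c (p.2 * (m.2 * S r.1))).
    apply: eq_bigr => q _; apply: eq_bigr => r _.
    have := comul_mul_forms (mul_form b (S r.2)) (mul_form c (S r.1)) y q.1.
    rewrite convE /= /mul_form => E.
    under eq_bigr do rewrite [_ * S r.2]mulrC [_ * S r.1]mulrC.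
    rewrite E; apply: eq_bigr => p _; apply: eq_bigr => m _.
    by congr (b _ * c _); rewrite mulrC mulrA.
  under eq_bigr do rewrite exchange_big.
  rewrite exchange_big; apply: eq_bigr => p _ /=.
  under eq_bigr do rewrite exchange_big.
  have := comul_antipode_cancel (mul_form b p.1) (mul_form c p.2) z.
  by rewrite /= /mul_form !mulr1.
rewrite -K1 -[in RHS](counitl G a) (linear_sum_of _ _ (Kr 1)).
transitivity (\sum_(p <- comul G a) \sum_(q <- comul G p.1)
  K (S q.1 * q.2) p.2).
  have T : trilinear (fun u v t : A => K (S u * v) t).
    split=> [v t|u t|u v] d m n; last exact: Kr.
      by rewrite linearP mulrDl -scalerAl Kl.
    by rewrite mulrDr -scalerAr Kl.
  rewrite (comulA G T); under eq_bigr do rewrite KM.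
  rewrite -{1}[a](counitr G) !linear_sum; apply: eq_bigr => p _.
  by rewrite linearZ dualZ.
apply: eq_bigr => p _.
have [f fE] := mk_linear (Kl p.2); have [g gE] := mk_linear (Kr 1).
under eq_bigr do rewrite -fE.
by rewrite -linear_sum antipodel linearZ fE -!gE linearZ.
Qed.

End Antipode.

(** * The invariant integral *)

Section Integral.
Variables (k : fieldType) (A : comAlgType k) (G : affine_group A).
Local Notation dual := {linear A -> k^o}.
Local Notation S := (antipode G).
Hypothesis ssG : linearly_semisimple G.
Variable w : dual.
Hypothesis wG : invariant_integral G w.
Local Notation F := (integral_form G w).

Lemma invariant_integral1 : w 1 = 1.
Proof.
case: wG => + _; move=> -> ; first exact: rmorph1.
by exists 1; rewrite ?scale1r.
Qed.

(** Invariance is linear in x, so it is enough to check it on the blocks: both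
    sides vanish on a block where w does, and the trivial block is spanned by
    1. *)
Lemma hitl_integral x : hitl G w x = w x *: 1.
Proof.
pose P := [set x | hitl G w x = w x *: 1].
apply: (@blocks_span _ _ G ssG P).
  split=> [|c y z Py Pz]; first by rewrite /P /= !linear0 scale0r.
  by rewrite /P /= linearP /= Py Pz (dualP w) scalerDl scalerA.
move=> C CB y Cy.
have [CE|CE] := pselect (C = @trivial_block k A); last first.
  have Cw := wG.2 _ CB CE.
  rewrite /P /= (annihilator_hitl ssG (block_bistable ssG CB) Cw Cy).
  by rewrite Cw // scale0r.
move: Cy; rewrite CE => -[c _ <-].
rewrite /P /= linearZ (dualZ w) -scalerA /=; congr (_ *: _).
rewrite /hitl (tensor_eq_map (scale_left_bilinear w) (comul1 G)).
by rewrite big_cons big_nil addr0.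
Qed.

(** By [comul_antipode], w o S is invariant on the other side, so w(x_1)
    w(S(x_2)) equals both w(x) and w(S(x)). *)
Lemma integral_antipode x : w (S x) = w x.
Proof.
pose wS : dual := w \o S.
have hitr_wS y : hitr G wS y = w (S y) *: 1.
  apply: (forms_separate_points ssG) => b; rewrite form_hitr.
  have -> : b = ((b \o S : dual) \o S : dual).
    by apply: linear_eq => z /=; rewrite antipodeK.
  rewrite -comul_antipode -form_hitl hitl_integral !dualZ /=.
  by rewrite !rmorph1.
have : conv G w wS x = conv G w wS x by [].
rewrite -{1}form_hitl -form_hitr hitl_integral hitr_wS !dualZ /=.
by rewrite rmorph1 invariant_integral1 !mulr1.
Qed.

Lemma integral_form_sym a x : F a x = F x a.
Proof.
rewrite -[LHS]/(w (S a * x)) -[RHS]/(w (S x * a)).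
by rewrite -integral_antipode rmorphM /= antipodeK mulrC.
Qed.

(** Expand w(y_1 x) 1 by invariance as w(y_1 x_1) y_2 x_2 and cancel y_2 with
    S(y_3). *)
Lemma integral_mul_antipode (c : dual) x y :
  \sum_(p <- comul G x) w (y * p.1) * c p.2 =
  \sum_(q <- comul G y) w (q.1 * x) * c (S q.2).
Proof.
have inv q : w (q.1 * x) * c (S q.2) = \sum_(p <- comul G x)
    \sum_(r <- comul G q.1) w (r.1 * p.1) * c (r.2 * S q.2 * p.2).
  have := form_hitl G w (mul_form c (S q.2)) (q.1 * x).
  rewrite hitl_integral dualZ /= /mul_form mulr1 => ->.
  rewrite (comul_mul_forms G w (mul_form c (S q.2))) exchange_big.
  apply: eq_bigr => p _; apply: eq_bigr => r _.
  by rewrite /= /mul_form mulrA [S _ * _]mulrC.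
under [RHS]eq_bigr do rewrite inv.
rewrite exchange_big; apply: eq_bigr => p _.
pose T (u v t : A) : k^o := w (u * p.1) * c (v * S t * p.2).
have TT : trilinear T.
  split=> [v t|u t|u v] d m n; rewrite /T.
  - by rewrite mulrDl -scalerAl (dualP w) mulrDl -[RHS]/(d * (_ * _) + _) mulrA.
  - by rewrite !mulrDl -!scalerAl (dualP c) mulrDr mulrCA.
  - rewrite linearP mulrDr mulrDl -scalerAr -scalerAl.
    by rewrite (dualP c) mulrDr mulrCA.
rewrite (comulA G TT y) /T -[in LHS](counitr G y).
rewrite mulr_suml linear_sum mulr_suml.
apply: eq_bigr => q _; rewrite -mulr_sumr -linear_sum -mulr_suml antipoder.
by rewrite -!scalerAl mul1r !dualZ mulrCA mulrA.
Qed.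

(** The operator x |-> F(a)(x_1) x_2 takes its values among the first factors
    a_1 of the comultiplication of a.  This confines F(a) to the block of a
    and makes its traces computable. *)
Lemma hitl_integral_form a x : hitl G (F a) x = hitr G (F x) a.
Proof.
apply: (forms_separate_points ssG) => c; rewrite form_hitl form_hitr.
rewrite convE -[LHS]/(\sum_(p <- comul G x) w (S a * p.1) * c p.2).
rewrite integral_mul_antipode.
have := comul_antipode G (mul_form w x) (c \o S : dual) a.
rewrite !convE /= /mul_form => E.
under eq_bigr do rewrite [_ * x]mulrC.
rewrite E; apply: eq_bigr => p _ /=; rewrite antipodeK; congr (_ * _).
by rewrite -[RHS]/(w (S x * p.2)) -integral_antipode rmorphM /= antipodeK.
Qed.

End Integral.

(** * The trace metric and its polarity *)

Section Trace.
Variables (k : fieldType) (A : comAlgType k) (G : affine_group A).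
Local Notation dual := {linear A -> k^o}.
Hypothesis ssG : linearly_semisimple G.

(** The trace does not depend on the basis; this is what makes [tr_dual],
    which picks some basis, linear in the form. *)
Lemma trace_dual_bases (C : set A) (b : dual) m n (e : 'I_m -> A) f
    (e' : 'I_n -> A) f' :
  bistable G C -> dual_bases C e f -> dual_bases C e' f' ->
  \sum_i f i (hitl G b (e i)) = \sum_j f' j (hitl G b (e' j)).
Proof.
move=> CB [eC _ Ce] [eC' _ Ce'].
transitivity (\sum_i \sum_j f' j (e i) * f i (hitl G b (e' j))).
  apply: eq_bigr => i _; rewrite {1}[e i]Ce' //.
  rewrite (linear_sum (hitl G b)) (linear_sum (f i)).
  by apply: eq_bigr => j _; rewrite linearZ dualZ.
rewrite exchange_big; apply: eq_bigr => j _ /=.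
rewrite [in RHS](Ce (hitl G b (e' j))); last exact: (CB.2 _ _ (eC' j)).1.
by rewrite linear_sum; apply: eq_bigr => i _; rewrite dualZ mulrC.
Qed.

Lemma tr_dualE (C : set A) (b : dual) n (e : 'I_n -> A) f :
  bistable G C -> dual_bases C e f ->
  tr_dual G C b = \sum_i f i (hitl G b (e i)).
Proof.
move=> CB ef; rewrite /tr_dual.
case: xgetP => [t _ [m [e' [f' [ef' ->]]]]|/(_ (\sum_i f i (hitl G b (e i))))].
  rewrite -(trace_dual_bases b CB ef' ef) /mxtrace; apply: eq_bigr => i _.
  by rewrite mxE form_hitl.
case; exists n, e, f; split=> //.
by rewrite /mxtrace; apply: eq_bigr => i _; rewrite mxE form_hitl.
Qed.

Lemma tr_dual_linear C (t : k) (b c d : dual) : blocks G C ->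
  (forall x, d x = t * b x + c x) ->
  tr_dual G C d = t * tr_dual G C b + tr_dual G C c.
Proof.
move=> CB dE; have [n [e [f ef]]] := block_dual_bases ssG CB.
rewrite !(tr_dualE _ (block_bistable ssG CB) ef) mulr_sumr -big_split.
apply: eq_bigr => i _ /=; rewrite -dualP; congr (f i _).
rewrite /hitl scaler_sumr -big_split; apply: eq_bigr => p _ /=.
by rewrite dE scalerDl scalerA.
Qed.

Lemma tr_dual_annihilator C b : blocks G C -> annihilator C b ->
  tr_dual G C b = 0.
Proof.
move=> CB Cb; have [n [e [f ef]]] := block_dual_bases ssG CB.
have CB' := block_bistable ssG CB.
rewrite (tr_dualE _ CB' ef) big1 // => i _; case: ef => eC _ _.
by rewrite (annihilator_hitl ssG CB' Cb (eC i)) linear0.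
Qed.

Lemma tr_dual_convC C b c : blocks G C ->
  tr_dual G C (conv G b c) = tr_dual G C (conv G c b).
Proof.
move=> CB; have [n [e [f ef]]] := block_dual_bases ssG CB.
have CB' := block_bistable ssG CB; rewrite !(tr_dualE _ CB' ef).
have [eC _ Ce] := ef.
have E (g h : dual) : \sum_i f i (hitl G (conv G g h) (e i)) =
    \sum_i \sum_j f j (hitl G g (e i)) * f i (hitl G h (e j)).
  apply: eq_bigr => i _; rewrite -hitl_hitl //.
  rewrite {1}(Ce (hitl G g (e i))); last exact: (CB'.2 _ _ (eC i)).1.
  rewrite (linear_sum (hitl G h)) (linear_sum (f i)).
  by apply: eq_bigr => j _; rewrite linearZ dualZ.
rewrite !E exchange_big; apply: eq_bigr => i _; apply: eq_bigr => j _.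
by rewrite mulrC.
Qed.

(** A finite list of blocks that carries b, so that the sum over all blocks
    defining its trace becomes a sum over this list. *)
Definition supported (b : dual) (r : seq (set A)) : Prop :=
  [/\ uniq r, forall C, C \in r -> blocks G C
    & forall C, blocks G C -> C \notin r -> annihilator C b].

Lemma AtildeP b : Atilde G b <-> exists r, supported b r.
Proof.
split=> [/finite_seqP[s sE]|[r [ru rB rb]]].
  have sP C : (blocks G C /\ ~ annihilator C b) <-> C \in s.
    by move/seteqP: sE => [+ +] => /(_ C) ? /(_ C) ?; split.
  exists (undup s); split=> [|C|C CB]; first exact: undup_uniq.
    by rewrite mem_undup => /sP[].
  rewrite mem_undup => /negP nC.
  by apply: contrapT => Cb; apply/nC/sP.
apply: (@sub_finite_set _ _ [set` r]); last exact: finite_seq.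
move=> C [CB Cb]; apply/negP/negP; apply: contrapT => /negP Cr; apply: Cb.
exact: rb.
Qed.

Lemma tr_supported b r : supported b r -> tr G b = \sum_(C <- r) tr_dual G C b.
Proof.
move=> [ru rB rb]; rewrite /tr (fsbigE r) //.
- rewrite big_mkcond big_seq [RHS]big_seq.
  by apply: eq_bigr => C /rB CB; rewrite mem_set.
- by move=> C CB /(rb _ CB); exact: tr_dual_annihilator.
Qed.

Lemma supported_conv b c r : supported b r ->
  supported (conv G b c) r /\ supported (conv G c b) r.
Proof.
move=> [ru rB rb]; split; split=> // C CB /(rb _ CB) Cb.
  by have [_ _ /(_ b c Cb)[]] := annihilator_ideal ssG (block_bistable ssG CB).
by have [_ _ /(_ b c Cb)[]] := annihilator_ideal ssG (block_bistable ssG CB).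
Qed.

Lemma Atilde_conv b c : Atilde G b -> Atilde G (conv G b c).
Proof.
by move=> /AtildeP[r /(supported_conv c)[? _]]; apply/AtildeP; exists r.
Qed.

Lemma trace_metric_sym b c : Atilde G b ->
  trace_metric G b c = trace_metric G c b.
Proof.
move=> /AtildeP[r rb]; have [bc cb] := supported_conv c rb.
rewrite /trace_metric (tr_supported bc) (tr_supported cb).
rewrite big_seq [RHS]big_seq; apply: eq_bigr => C Cr.
by apply: tr_dual_convC; case: rb => _ /(_ _ Cr).
Qed.

Lemma supported_cat b r r' : supported b r ->
  (forall C, C \in r' -> blocks G C) -> supported b (undup (r ++ r')).
Proof.
move=> [ru rB rb] r'B; split; first exact: undup_uniq.
  by move=> C; rewrite mem_undup mem_cat => /orP[/rB|/r'B].
move=> C CB; rewrite mem_undup mem_cat negb_or => /andP[Cr _]; exact: rb.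
Qed.

Lemma tr_linear (t : k) (b c d : dual) : Atilde G b -> Atilde G c ->
  (forall x, d x = t * b x + c x) -> Atilde G d /\ tr G d = t * tr G b + tr G c.
Proof.
move=> /AtildeP[r rb] /AtildeP[r' rc] dE.
have {rb rc} [s [sb sc]] : exists s, supported b s /\ supported c s.
  exists (undup (r ++ r')); split.
    by apply: supported_cat => //; case: rc.
  have := supported_cat rc (r' := r); have [_ rB _] := rb => /(_ rB) [u uB uc].
  split; first exact: undup_uniq.
    by move=> C; rewrite mem_undup mem_cat orbC -mem_cat -mem_undup; exact: uB.
  by move=> C CB; rewrite mem_undup mem_cat orbC -mem_cat -mem_undup; exact: uc.
have sd : supported d s.
  have [su sB bE] := sb; have [_ _ cE] := sc; split=> // C CB Cs x Cx.
  by rewrite dE (bE C) // (cE C) // mulr0 addr0.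
split; first by apply/AtildeP; exists s.
rewrite (tr_supported sb) (tr_supported sc) (tr_supported sd).
rewrite mulr_sumr -big_split big_seq [RHS]big_seq; apply: eq_bigr => C Cs.
by apply: tr_dual_linear dE; case: sb => _ /(_ _ Cs).
Qed.

(** On a block with dual bases e and f, the trace of b b' is the value of b'
    at the sum of the elements hitr (f i) (hitl b (e i)). *)
Lemma trace_metric_represented b : Atilde G b ->
  exists a : A, forall b' : dual, b' a = trace_metric G b b'.
Proof.
move=> /AtildeP[r rb].
suff [a aE] : exists a : A, forall b' : dual,
    b' a = \sum_(C <- r) tr_dual G C (conv G b b').
  exists a => b'; rewrite aE /trace_metric.
  by rewrite (tr_supported (supported_conv b' rb).1).
have rB : forall C, C \in r -> blocks G C by case: rb.
elim: r rB {rb} => [|C r IH] rB.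
  by exists 0 => b'; rewrite linear0 big_nil.
have [|a aE] := IH; first by move=> D Dr; apply: rB; rewrite inE Dr orbT.
have CB : blocks G C by apply: rB; rewrite mem_head.
have [n [e [f ef]]] := block_dual_bases ssG CB.
exists (\sum_i hitr G (f i) (hitl G b (e i)) + a) => b'.
rewrite big_cons linearD aE (tr_dualE _ (block_bistable ssG CB) ef).
rewrite linear_sum; congr (_ + _); apply: eq_bigr => i _.
by rewrite form_hitr -form_hitl hitl_hitl.
Qed.

Variable w : dual.
Hypothesis wG : invariant_integral G w.
Local Notation F := (integral_form G w).

Lemma integral_form_linear_in (t : k) a a' x :
  F (t *: a + a') x = t * F a x + F a' x.
Proof.
rewrite !(integral_form_sym ssG wG _ x); exact: dualP.
Qed.

Lemma integral_form_supported C a : blocks G C -> C a -> supported (F a) [:: C].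
Proof.
move=> CB Ca; split=> // [D|D DB]; rewrite inE; first by move/eqP->.
move=> /eqP DC y Dy; rewrite -(counit_hitl G).
suff : (C `&` D) (hitl G (F a) y).
  rewrite (blocks_disjoint ssG) => [->|//|//|CD]; last exact: DC.
  by rewrite linear0.
split; last by have [] := (block_bistable ssG DB).2 (F a) y Dy.
rewrite (hitl_integral_form ssG wG).
by have [] := (block_bistable ssG CB).2 (F y) a Ca.
Qed.

(** By [hitl_integral_form] the trace is the sum over i of F(e i)(y_2)
    f_i(y_1), with y = hitl b a.  By symmetry of F and duality of the bases it
    is F(y_2)(y_1) = w(S(y_2) y_1) = counit y, that is, b a. *)
Lemma tr_dual_integral_form C a b : blocks G C -> C a ->
  tr_dual G C (conv G (F a) b) = b a.
Proof.
move=> CB Ca; have [n [e [f ef]]] := block_dual_bases ssG CB.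
have CB' := block_bistable ssG CB; rewrite (tr_dualE _ CB' ef).
have [eC _ Ce] := ef.
set y := hitl G b a; have Cy : C y by have [] := CB'.2 b a Ca.
(* The expansion in the basis e requires first factors that lie in C. *)
have [s [ys sC]] := ((subcoalgebraP ssG C).2 CB').2 _ Cy.
have Bi (c d : dual) : bilinear_map (fun u v : A => c v * d u : k^o).
  split=> [v|u] t z z'; rewrite dualP -[RHS]/(t * _ + _).
    by rewrite mulrDr mulrCA.
  by rewrite mulrDl -mulrA.
transitivity (\sum_i \sum_(p <- s) f i p.1 * F p.2 (e i)).
  apply: eq_bigr => i _; rewrite -hitl_hitl // (hitl_integral_form ssG wG).
  rewrite hitl_hitr // -/y form_hitr convE.
  under eq_bigr do rewrite mulrC.
  rewrite (tensor_eq_map (Bi (F (e i)) (f i)) ys); apply: eq_bigr => p _.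
  by rewrite mulrC (integral_form_sym ssG wG).
have Bw : bilinear_map (fun u v : A => F v u).
  split=> [v|u] t z z'; first exact: linearP.
  exact: integral_form_linear_in.
transitivity (\sum_(p <- s) F p.2 p.1).
  rewrite exchange_big big_seq [RHS]big_seq; apply: eq_bigr => p ps.
  rewrite [in RHS](Ce p.1); last by case: (sC _ ps).
  by rewrite linear_sum; apply: eq_bigr => i _; rewrite dualZ.
rewrite -(tensor_eq_map Bw ys) /=.
transitivity (w (\sum_(p <- comul G y) p.1 * antipode G p.2)).
  by rewrite linear_sum; apply: eq_bigr => p _; rewrite mulrC.
by rewrite antipoder dualZ (invariant_integral1 wG) mulr1 counit_hitl.
Qed.

Lemma integral_form_metric a :
  Atilde G (F a) /\ forall b : dual, trace_metric G (F a) b = b a.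
Proof.
pose P := [set a |
  Atilde G (F a) /\ forall b : dual, trace_metric G (F a) b = b a].
apply: (@blocks_span _ _ _ ssG P) => [|C CB x Cx].
  have F0 : F 0 = \0 :> dual.
    apply: linear_eq => x.
    by rewrite (integral_form_sym ssG wG) linear0.
  split.
    have s0 : supported (F 0) [::] by split=> // C _ _ x _; rewrite F0.
    split; first by apply/AtildeP; exists [::].
    move=> b; rewrite /trace_metric (tr_supported (supported_conv b s0).1).
    by rewrite big_nil linear0.
  move=> t x y [Ax xE] [Ay yE].
  have E z : F (t *: x + y) z = t * F x z + F y z.
    exact: integral_form_linear_in.
  split; first by have [] := tr_linear Ax Ay E.
  move=> b; rewrite dualP -xE -yE /trace_metric.
  have [|_ ->//] := tr_linear (Atilde_conv b Ax) (Atilde_conv b Ay)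
     (t := t) (d := conv G (F (t *: x + y)) b).
  by move=> z; rewrite -!form_hitr E.
have s := integral_form_supported CB Cx.
split; first by apply/AtildeP; exists [:: C].
move=> b; rewrite /trace_metric (tr_supported (supported_conv b s).1).
by rewrite big_seq1 tr_dual_integral_form.
Qed.

End Trace.

Theorem theorem2p3 (k : fieldType) (A : comAlgType k) (G : affine_group A)
    (w : {linear A -> k^o}) :
  linearly_semisimple G -> invariant_integral G w ->
  exists F : A -> Atilde G,
    [/\ forall a, \val (F a) = integral_form G w a,
        exists phi : Atilde G -> A, is_polarity phi
      & forall phi : Atilde G -> A, is_polarity phi ->
          cancel F phi /\ cancel phi F].
Proof.
move=> ssG wG; have FP := integral_form_metric ssG wG.
pose F a : Atilde G := exist _ (integral_form G w a) (mem_set (FP a).1).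
exists F; split=> // [|phi phiP].
  have ex (b : Atilde G) : exists a : A,
      forall b' : {linear A -> k^o}, b' a = trace_metric G (\val b) b'.
    exact: (trace_metric_represented ssG (set_mem (valP b))).
  by exists (fun b => projT1 (cid (ex b))) => b b'; case: cid.
have phiK : cancel phi F.
  move=> b; apply: val_inj; apply: linear_eq => x.
  rewrite /= (integral_form_sym ssG wG).
  rewrite -[LHS]/(\val (F x) (phi b)) phiP.
  by rewrite (trace_metric_sym ssG) ?(FP x).2 //; exact: set_mem (valP b).
split=> // a; apply: (forms_separate_points ssG) => b.
rewrite -(FP a).2 -(FP (phi (F a))).2; congr (trace_metric G _ b).
by rewrite -[RHS]/(\val (F a)) -{2}(phiK (F a)).
Qed.
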